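(* Let $f:\mathbb{R}^{d_1}\times\mathbb{R}^{d_2}\to\mathbb{R}$ be continuously differentiable with Lipschitz gradient with constant $l>0$, and suppose that $-f(x,\cdot)$ satisfies the PL condition with constant $\mu>0$ for every $x$, where $\mu\le l$. Let $\kappa=l/\mu$. Let $T\ge 0$ be an integer, let $(x_t,y_t)_{t=0}^T$ be generated by AGDA with $\tau_1=\frac1{20\kappa^2l}$ and $\tau_2=\frac1l$, and let $(x^T,y^T)$ be chosen uniformly at random from $\{(x_t,y_t)\}_{t=0}^T$. Then $$\mathbb{E}\|\nabla g(x^T)\|^2\le\frac{8}{T+1}\big[10\kappa^2l\,a_0+\kappa^2l\,b_0\big],$$ where $a_0=g(x_0)-g^*$ and $b_0=g(x_0)-f(x_0,y_0)$.
   Context: Norms are Euclidean. Lipschitz gradient with constant $l$: for all $x_1,x_2\in\mathbb{R}^{d_1}$, $y_1,y_2\in\mathbb{R}^{d_2}$, $\|\nabla_x f(x_1,y_1)-\nabla_x f(x_2,y_2)\|\le l[\|x_1-x_2\|+\|y_1-y_2\|]$ and $\|\nabla_y f(x_1,y_1)-\nabla_y f(x_2,y_2)\|\le l[\|x_1-x_2\|+\|y_1-y_2\|]$. PL condition for $-f(x,\cdot)$ with constant $\mu$: $\max_{y'}f(x,y')$ has a nonempty solution set and finite value, and $\|\nabla_yf(x,y)\|^2\ge2\mu[\max_{y'}f(x,y')-f(x,y)]$ for all $y$. No condition besides smoothness is imposed on $f(\cdot,y)$. $g(x):=\max_yf(x,y)$ (which is differentiable under these hypotheses) and $g^*$ is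 the optimal (infimal) value of $g$, assumed finite. AGDA: from a given $(x_0,y_0)$, for $t=0,\dots,T-1$, $x_{t+1}=x_t-\tau_1\nabla_xf(x_t,y_t)$, then $y_{t+1}=y_t+\tau_2\nabla_yf(x_{t+1},y_t)$. The expectation is over the random choice of index. *)

(* Defs.v *)
From HB Require Import structures.
From mathcomp Require Import all_boot all_order all_algebra.
From mathcomp Require Import all_classical all_reals all_analysis.

Set Implicit Arguments.
Unset Strict Implicit.
Unset Printing Implicit Defensive.

Import Order.TTheory GRing.Theory Num.Theory.
Import numFieldNormedType.Exports.

Local Open Scope classical_set_scope.
Local Open Scope ring_scope.

(* The canonical norm `|v| of 'rV[R]_n is the sup norm, hence this definition.
   The two norms induce the same topology, so the library's [differentiable]
   and [continuous] have their usual meaning. *)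
Definition enorm (R : realType) (n : nat) (v : 'rV[R]_n) : R :=
  Num.sqrt (\sum_(i < n) v 0 i ^+ 2).

Definition gradient (R : realType) (n : nat) (h : 'rV[R]_n -> R)
    (x : 'rV[R]_n) : 'rV[R]_n :=
  \row_(i < n) 'D_(delta_mx 0 i) h x.

Section minimax.
Variables (R : realType) (d1 d2 : nat).
Implicit Types (f : 'rV[R]_d1 * 'rV[R]_d2 -> R) (z : 'rV[R]_d1 * 'rV[R]_d2).

Definition grad_x f z : 'rV[R]_d1 := gradient (fun x => f (x, z.2)) z.1.

Definition grad_y f z : 'rV[R]_d2 := gradient (fun y => f (z.1, y)) z.2.

Definition continuously_differentiable f : Prop :=
  [/\ forall z, differentiable f z,
      continuous (grad_x f) & continuous (grad_y f)].

Definition lipschitz_gradient f (l : R) : Prop :=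
  forall x1 x2 y1 y2,
    enorm (grad_x f (x1, y1) - grad_x f (x2, y2))
      <= l * (enorm (x1 - x2) + enorm (y1 - y2)) /\
    enorm (grad_y f (x1, y1) - grad_y f (x2, y2))
      <= l * (enorm (x1 - x2) + enorm (y1 - y2)).

(* g(x) = max_y f(x, y). [sup] is a junk value when f(x, .) is unbounded above;
   [PL_neg_y] below requires the maximum to be attained. *)
Definition max_fun f (x : 'rV[R]_d1) : R := sup (range (fun y => f (x, y))).

(* The Polyak-Lojasiewicz condition for - f(x, .). *)
Definition PL_neg_y f (mu : R) (x : 'rV[R]_d1) : Prop :=
  (exists ystar, forall y, f (x, y) <= f (x, ystar)) /\
  (forall y,
     2 * mu * (max_fun f x - f (x, y)) <= enorm (grad_y f (x, y)) ^+ 2).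

Definition agda_step f (tau1 tau2 : R) z : 'rV[R]_d1 * 'rV[R]_d2 :=
  let x := z.1 - tau1 *: grad_x f z in
  (x, z.2 + tau2 *: grad_y f (x, z.2)).

Definition agda f (tau1 tau2 : R) z (t : nat) : 'rV[R]_d1 * 'rV[R]_d2 :=
  iter t (agda_step f tau1 tau2) z.

End minimax.

(* These T + 1 values carry all the mass, so U lies in {0, ..., T} almost
   surely. *)
Definition uniform_index (R : realType) (d : measure_display)
    (Omega : measurableType d) (P : probability Omega R)
    (U : {RV P >-> nat}) (T : nat) : Prop :=
  forall t : nat, (t <= T)%N -> P (U @^-1` [set t]) = (T.+1%:R^-1)%:E.

(* Main.v *)
Require Import Defs.
From HB Require Import structures.
From mathcomp Require Import all_boot all_order all_algebra.
From mathcomp Require Import all_classical all_reals all_analysis.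
From mathcomp Require Import measurable_realfun ring lra.

(* Lyapunov argument with potential a_t + b_t / 10, where a_t = g(x_t) - g^* and
   b_t = g(x_t) - f(x_t, y_t).

   Let y be a maximizer of f(x, .). Since the gradient of f(x + w, .) at y has
   norm at most l |w|, the PL condition at x + w gives
   g(x + w) <= f(x + w, y) + l^2 |w|^2 / (2 mu); with g(x + w) >= f(x + w, y),
   this shows that g is differentiable with gradient grad_x f(x, y) and
   satisfies a descent inequality with constant l + l^2 / mu.

   The error |grad g(x) - grad_x f(x, y)|^2 at an arbitrary y is at most
   (32 / 9) (l^2 / mu) (g(x) - f(x, y)): a constant that is too large follows
   from the two quadratic bounds on g, and is improved by following gradient
   ascent from y, whose total length is controlled by sqrt (g(x) - f(x, y)).

   One step of AGDA then decreases the potential by at least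
   (tau1 / 4) |grad g(x_t)|^2, and these inequalities telescope. *)

Set Implicit Arguments.
Unset Strict Implicit.
Unset Printing Implicit Defensive.

Import Order.TTheory GRing.Theory Num.Theory.
Import numFieldNormedType.Exports.

Local Open Scope classical_set_scope.
Local Open Scope ring_scope.

(** * Euclidean inner product and norm on row vectors *)

Definition dot {R : realType} {n : nat} (u v : 'rV[R]_n) : R :=
  \sum_(i < n) u 0 i * v 0 i.

Section euclidean.
Context {R : realType} {n : nat}.
Implicit Types (u v w : 'rV[R]_n) (a : R).

Lemma dotC u v : dot u v = dot v u.
Proof. by apply: eq_bigr => i _; rewrite mulrC. Qed.

Lemma dot_is_linear u : linear (dot u).
Proof.
move=> a v w; rewrite /dot scaler_sumr -big_split /=; apply: eq_bigr => i _.
by rewrite !mxE /GRing.scale /=; ring.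
Qed.

HB.instance Definition _ u :=
  GRing.isLinear.Build R 'rV[R]_n R _ (dot u) (dot_is_linear u).

Lemma dotDr u v w : dot u (v + w) = dot u v + dot u w.
Proof. exact: linearD. Qed.
Lemma dotBr u v w : dot u (v - w) = dot u v - dot u w.
Proof. exact: linearB. Qed.
Lemma dotZr a u v : dot u (a *: v) = a * dot u v.
Proof. exact: linearZ. Qed.
Lemma dotDl u v w : dot (u + v) w = dot u w + dot v w.
Proof. by rewrite dotC dotDr !(dotC w). Qed.
Lemma dotBl u v w : dot (u - v) w = dot u w - dot v w.
Proof. by rewrite dotC dotBr !(dotC w). Qed.
Lemma dotNr u v : dot u (- v) = - dot u v.
Proof. exact: linearN. Qed.
Lemma dotNl u v : dot (- u) v = - dot u v.
Proof. by rewrite dotC linearN dotC. Qed.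
Lemma dotZl a u v : dot (a *: u) v = a * dot u v.
Proof. by rewrite dotC dotZr dotC. Qed.

Lemma dotvv_ge0 u : 0 <= dot u u.
Proof. by apply: sumr_ge0 => i _; rewrite -expr2 sqr_ge0. Qed.

Lemma sqr_enorm u : enorm u ^+ 2 = dot u u.
Proof.
rewrite /enorm sqr_sqrtr; first by apply: eq_bigr => i _; rewrite expr2.
by apply: sumr_ge0 => i _; rewrite sqr_ge0.
Qed.

Lemma enorm_ge0 u : 0 <= enorm u.
Proof. exact: sqrtr_ge0. Qed.

Lemma enorm_le u a : 0 <= a -> (enorm u <= a) = (dot u u <= a ^+ 2).
Proof. by move=> a0; rewrite -sqr_enorm ler_sqr // nnegrE enorm_ge0. Qed.

Lemma enorm0 : enorm (0 : 'rV[R]_n) = 0.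
Proof.
by apply/eqP; rewrite -(sqrf_eq0 (enorm _)) sqr_enorm linear0.
Qed.

Lemma enorm_eq0 u : enorm u = 0 -> u = 0.
Proof.
move=> /(congr1 (fun x => x ^+ 2)); rewrite sqr_enorm expr0n /= => /eqP.
rewrite psumr_eq0 => [/allP u0|i _]; last by rewrite -expr2 sqr_ge0.
apply/rowP => i; rewrite mxE; apply/eqP.
by have := u0 i (mem_index_enum _); rewrite /= mulf_eq0 orbb.
Qed.

(** The square of [enorm v *: u - enorm u *: v] expands to [2 |u| |v| (|u| |v| - dot u v)], where
    both norms may be taken positive. *)
Lemma cauchy_schwarz u v : dot u v <= enorm u * enorm v.
Proof.
have [/enorm_eq0 ->|u0] := eqVneq (enorm u) 0.
  by rewrite dotC linear0 enorm0 mul0r.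
have [/enorm_eq0 ->|v0] := eqVneq (enorm v) 0.
  by rewrite linear0 enorm0 mulr0.
have up : 0 < enorm u by rewrite lt_neqAle eq_sym u0 enorm_ge0.
have vp : 0 < enorm v by rewrite lt_neqAle eq_sym v0 enorm_ge0.
have := dotvv_ge0 (enorm v *: u - enorm u *: v).
rewrite dotBl !dotBr !dotZl !dotZr (dotC v u) -!sqr_enorm.
move: (enorm u) (enorm v) (dot u v) up vp => a b c a0 b0.
have -> : b * (b * a ^+ 2) - b * (a * c) - (a * (b * c) - a * (a * b ^+ 2))
  = 2 * ((a * b) * (a * b - c)) by ring.
by rewrite pmulr_rge0 // pmulr_rge0 ?mulr_gt0 // subr_ge0.
Qed.

Lemma ler_enormD u v : enorm (u + v) <= enorm u + enorm v.
Proof.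
rewrite enorm_le ?addr_ge0 ?enorm_ge0 // dotDl !dotDr (dotC v u).
have := cauchy_schwarz u v; rewrite -!sqr_enorm; nra.
Qed.

Lemma enormZ a u : enorm (a *: u) = `|a| * enorm u.
Proof.
apply/eqP; rewrite -(eqrXn2 (n := 2)) ?mulr_ge0 ?enorm_ge0 //.
by rewrite sqr_enorm exprMn real_normK ?num_real // sqr_enorm dotZl dotZr mulrA.
Qed.

Lemma enormN u : enorm (- u) = enorm u.
Proof. by rewrite -scaleN1r enormZ normrN1 mul1r. Qed.

(** Comparison with the sup norm, in which the library measures little-o; it serves
    [quadratic_gradient]. *)
Lemma sqr_enorm_le_norm u : enorm u ^+ 2 <= n%:R * `|u| ^+ 2.
Proof.
rewrite sqr_enorm -[n in n%:R]card_ord mulr_natl -sumr_const.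
apply: ler_sum => i _; rewrite -expr2 -(@real_normK _ (u 0 i)) ?num_real //.
rewrite ler_pXn2r ?nnegrE // [leRHS]mx_normrE.
exact: (le_bigmax _ (fun i : 'I_1 * 'I_n => `|u i.1 i.2|) (0, i)).
Qed.

Lemma dot_continuous u : continuous (dot u).
Proof.
move=> v; apply: (@cvg_big _ _ +%R) => [||i _].
- exact: add_continuous.
- exact: nbhs_filter.
- apply: (@continuousM _ _ (fun=> u 0 i) (fun w : 'rV_n => w 0 i)).
    exact: cst_continuous.
  exact: coord_continuous.
Qed.

End euclidean.

(** * Functions with Lipschitz gradient and their quadratic bounds *)

Section smooth.
Context {R : realType} {n : nat}.
Implicit Types (h : 'rV[R]_n -> R) (u v w : 'rV[R]_n).

Lemma derive_gradient h u v :
  differentiable h u -> 'D_v h u = dot (gradient h u) v.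
Proof.
move=> dh; rewrite deriveE // [in LHS](row_sum_delta v) linear_sum.
by apply: eq_bigr => i _; rewrite linearZ !mxE deriveE // mulrC.
Qed.

(** Chain rule along a line: the difference quotient in [s] is the one that defines the directional
    derivative along [w]. *)
Lemma is_derive_line h u w (t : R) : differentiable h (u + t *: w) ->
  is_derive t 1 (fun s : R => h (u + s *: w)) (dot (gradient h (u + t *: w)) w).
Proof.
move=> dh.
have E : (fun s : R => s^-1 *: (((fun s => h (u + s *: w)) \o shift t) (s *: 1)
           - h (u + t *: w))) =
  (fun s : R => s^-1 *: ((h \o shift (u + t *: w)) (s *: w) - h (u + t *: w))).
  apply/funext => s /=; congr (_ *: (h _ - _)).
  by rewrite -[s *: 1]/(s * 1) mulr1 scalerDl addrCA.
have dw : derivable h (u + t *: w) w by exact: diff_derivable.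
apply: DeriveDef; first by rewrite /derivable E.
by rewrite -derive_gradient // /derive E.
Qed.

Definition lsmooth (h : 'rV[R]_n -> R) (l : R) :=
  (forall u, differentiable h u) /\
  (forall u v, enorm (gradient h u - gradient h v) <= l * enorm (u - v)).

Lemma lsmooth_upper h (l : R) u w : 0 <= l -> lsmooth h l ->
  h (u + w) <= h u + dot (gradient h u) w + l / 2 * enorm w ^+ 2.
Proof.
move=> l0 [dh lh].
(* On the open unit interval the derivative of [phi] is nonpositive, by Cauchy-Schwarz and the
   Lipschitz bound; [phi 1 <= phi 0] is then the claim. *)
pose phi (t : R) : R := h (u + t *: w) - t * dot (gradient h u) w
  - t ^+ 2 * (l / 2 * enorm w ^+ 2).
have dphi (t : R) : is_derive t (1 : R) phi (dot (gradient h (u + t *: w)) w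
    - dot (gradient h u) w - t * (l * enorm w ^+ 2)).
  have d1 := is_derive_line (dh (u + t *: w)).
  apply: is_derive_eq.
  rewrite /GRing.scale /=; set D := dot _ _; by field.
have : phi 1 <= phi 0.
  apply: (@ler0_derive1_le_cc R phi 0 1); rewrite ?in_itv /= ?lexx ?ler01 //.
  - move=> t; rewrite in_itv /= => /andP[t0 t1].
    rewrite derive1E; have [_ ->] := dphi t.
    have := cauchy_schwarz (gradient h (u + t *: w) - gradient h u) w.
    rewrite dotBl; have := lh (u + t *: w) u.
    rewrite addrAC subrr add0r enormZ gtr0_norm //.
    have := enorm_ge0 w; nra.
  - apply: continuous_subspaceT => t.
    by apply/differentiable_continuous/derivable1_diffP; case: (dphi t).
rewrite /phi scale1r scale0r addr0; lra.
Qed.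

Lemma gradientN h u : differentiable h u ->
  gradient (- h) u = - gradient h u.
Proof.
move=> dh; apply/rowP => i; rewrite !mxE deriveN //.
exact: diff_derivable.
Qed.

Lemma lsmoothN h (l : R) : lsmooth h l -> lsmooth (- h) l.
Proof.
move=> [dh lh]; split=> [u|u v]; first exact: differentiableN.
by rewrite !gradientN // -opprD enormN.
Qed.

Lemma lsmooth_lower h (l : R) u w : 0 <= l -> lsmooth h l ->
  h u + dot (gradient h u) w - l / 2 * enorm w ^+ 2 <= h (u + w).
Proof.
move=> l0 sh; have := lsmooth_upper u w l0 (lsmoothN sh).
rewrite gradientN; last by case: sh.
rewrite dotNl !fctE; lra.
Qed.

(** A quadratic error is [o(w)], so [dot G] is the differential by uniqueness. *)
Lemma quadratic_gradient h u G (c : R) :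
  (forall w, `|h (u + w) - h u - dot G w| <= c * enorm w ^+ 2) ->
  differentiable h u /\ gradient h u = G.
Proof.
move=> hc.
pose df : {linear 'rV[R]_n -> R} := dot G.
have cdf : continuous df := @dot_continuous R n G.
have E : h \o shift u = cst (h u) + df +o_ (0 : 'rV[R]_n) id.
  apply/eqaddoP => e e0.
  (* The [+ 1] keeps this constant invertible when [c] or [n] is zero. *)
  have c0 : 0 < `|c| * n%:R + 1 by rewrite ltr_wpDl // mulr_ge0.
  have nearc : \forall w \near (0 : 'rV[R]_n),
      `|w| <= (`|c| * n%:R + 1)^-1 * e.
    apply: pseudometric_normed_Zmodule.nbhs0_le.
    by rewrite mulr_gt0 ?invr_gt0.
  near=> w.
  rewrite !fctE /= [w + u]addrC opprD addrA.
  apply: (le_trans (hc w)).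
  apply: (@le_trans _ _ (`|c| * (n%:R * `|w| ^+ 2))).
    apply: (@le_trans _ _ (`|c| * enorm w ^+ 2)).
      by rewrite ler_wpM2r ?sqr_ge0 // ler_norm.
    by rewrite ler_wpM2l // sqr_enorm_le_norm.
  apply: (@le_trans _ _ ((`|c| * n%:R + 1) * `|w| * `|w|)).
    rewrite -mulrA -expr2 mulrA ler_wpM2r ?sqr_ge0 // lerDl //.
  rewrite ler_wpM2r // -ler_pdivlMl //.
  near: w.
  exact: nearc.
have D := diff_unique cdf E.
have dh : differentiable h u.
  by apply/diff_locallyP; rewrite D.
split => //; apply/rowP => i; rewrite mxE deriveE // D.
rewrite -[LHS]/(dot G (delta_mx 0 i)) /dot (bigD1 i) //= big1 ?addr0 => [|j ji].
  by rewrite mxE !eqxx mulr1.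
by rewrite mxE (negPf ji) andbF mulr0.
Unshelve. all: by end_near. Qed.

End smooth.

(** * The maximum function [g]: attainment, gradient and descent *)

Section max_function.
Context {R : realType} {d1 d2 : nat}.
Context (f : 'rV[R]_d1 * 'rV[R]_d2 -> R) (l mu : R).
Context (l_gt0 : 0 < l) (mu_gt0 : 0 < mu).
Context (f_diff : forall z, differentiable f z).
Context (f_lip : lipschitz_gradient f l) (f_PL : forall x, PL_neg_y f mu x).

Let g := max_fun f.
Let l_ge0 : 0 <= l := ltW l_gt0.

Lemma lsmooth_x y : lsmooth (fun x => f (x, y)) l.
Proof.
split=> [u|u v].
  apply: (@differentiable_comp _ _ _ _ (fun x => (x, y)) f) => //.
by have [+ _] := f_lip u v y y; rewrite subrr enorm0 addr0.
Qed.

Lemma lsmooth_y x : lsmooth (fun y => f (x, y)) l.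
Proof.
split=> [u|u v].
  apply: (@differentiable_comp _ _ _ _ (fun y => (x, y)) f) => //.
by have [_ +] := f_lip x x u v; rewrite subrr enorm0 add0r.
Qed.

Lemma max_fun_ge x y : f (x, y) <= g x.
Proof.
have [[ystar ymax] _] := f_PL x.
apply: ub_le_sup; last by exists y.
by exists (f (x, ystar)) => _ [y' _ <-].
Qed.

Lemma max_fun_attained x : exists y, g x = f (x, y).
Proof.
have [[ystar ymax] _] := f_PL x; exists ystar.
apply/eqP; rewrite eq_le max_fun_ge andbT.
apply: ge_sup; first by exists (f (x, ystar)), ystar.
by move=> _ [y' _ <-].
Qed.

(** One gradient ascent step of any length: [eta = 1/l] is the step of AGDA, and [eta = 1/(2l)] is
    that of the auxiliary ascent [next] below. *)
Lemma ascent_y x y (eta : R) :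
  f (x, y) + eta * (1 - l * eta / 2) * enorm (grad_y f (x, y)) ^+ 2
  <= f (x, y + eta *: grad_y f (x, y)).
Proof.
have := lsmooth_lower y (eta *: grad_y f (x, y)) l_ge0 (lsmooth_y x).
rewrite -[gradient _ y]/(grad_y f (x, y)) !sqr_enorm dotZl !dotZr.
nra.
Qed.

(** Otherwise an ascent step with [eta = 1/l] would raise [f (x, .)] above its maximum. *)
Lemma grad_y_argmax x y : g x = f (x, y) -> grad_y f (x, y) = 0.
Proof.
move=> gf; apply: enorm_eq0; apply/eqP; rewrite -sqrf_eq0 eq_le sqr_ge0 andbT.
have := le_trans (ascent_y x y l^-1) (max_fun_ge x _).
rewrite gf -lerBrDl subrr mulfV ?gt_eqF //.
have := invr_gt0 l; rewrite l_gt0; set p := _ ^+ 2 => il; nra.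
Qed.

Lemma max_fun_lower x y w :
  f (x, y) + dot (grad_x f (x, y)) w - l / 2 * enorm w ^+ 2 <= g (x + w).
Proof.
apply: le_trans (max_fun_ge _ y).
exact: lsmooth_lower x w l_ge0 (lsmooth_x y).
Qed.

Lemma max_fun_upper x y w : g x = f (x, y) ->
  g (x + w) <= g x + dot (grad_x f (x, y)) w
               + (l + l ^+ 2 / mu) / 2 * enorm w ^+ 2.
Proof.
move=> gf; have [_ /(_ y) PL] := f_PL (x + w).
have U := lsmooth_upper x w l_ge0 (lsmooth_x y).
have [_ +] := f_lip (x + w) x y y.
rewrite (grad_y_argmax gf) subr0 subrr enorm0 addr0 addrAC subrr add0r => pw.
rewrite gf.
have {}PL : 2 * mu * (g (x + w) - f (x + w, y)) <= l ^+ 2 * enorm w ^+ 2.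
  rewrite -exprMn; apply: le_trans PL _.
  by rewrite ler_pXn2r ?nnegrE ?mulr_ge0 ?enorm_ge0.
have {}PL : g (x + w) - f (x + w, y) <= l ^+ 2 * enorm w ^+ 2 / (2 * mu).
  by rewrite ler_pdivlMr ?mulr_gt0 // mulrC.
have E : l ^+ 2 * enorm w ^+ 2 / (2 * mu) = l ^+ 2 / mu / 2 * enorm w ^+ 2.
  by field; rewrite gt_eqF.
rewrite E in PL.
move: U PL; rewrite -[gradient _ x]/(grad_x f (x, y)) /=.
set D := dot _ _; set W := enorm w ^+ 2; lra.
Qed.

(** An envelope theorem of Danskin type: [max_fun_lower] and [max_fun_upper] have the same linear
    term and touch at [w = 0]. *)
Lemma gradient_max_fun x y : g x = f (x, y) ->
  differentiable g x /\ gradient g x = grad_x f (x, y).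
Proof.
move=> gf; apply: (@quadratic_gradient _ _ _ _ _ ((l + l ^+ 2 / mu) / 2)) => w.
have := max_fun_lower x y w; have := max_fun_upper w gf; rewrite gf.
have : 0 <= l ^+ 2 / mu / 2 * enorm w ^+ 2.
  by rewrite mulr_ge0 ?sqr_ge0 // divr_ge0 // divr_ge0 ?sqr_ge0 // ltW.
have : 0 <= l * enorm w ^+ 2 by rewrite mulr_ge0 ?sqr_ge0.
set D := dot _ _; set W := enorm w ^+ 2 => *.
rewrite ler_norml; apply/andP; split; lra.
Qed.

Lemma differentiable_max_fun x : differentiable g x.
Proof. by have [y /gradient_max_fun[]] := max_fun_attained x. Qed.

Lemma max_fun_descent x w :
  g (x + w) <= g x + dot (gradient g x) w
               + (l + l ^+ 2 / mu) / 2 * enorm w ^+ 2.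
Proof.
have [y gf] := max_fun_attained x.
have [_ ->] := gradient_max_fun gf; exact: max_fun_upper.
Qed.

(** Comparing the lower and upper bounds on [g (x + w)] gives [- dot e w - c / 2 |w|^2 <= g x - f
    (x, y)], where [c] adds the two curvatures. The choice [w = - e / c] maximizes the left side,
    which becomes [|e|^2 / (2 c)]. *)
Lemma sqr_gradient_gap_coarse x y :
  enorm (gradient g x - grad_x f (x, y)) ^+ 2
  <= (4 * l + 2 * l ^+ 2 / mu) * (g x - f (x, y)).
Proof.
set e := gradient g x - grad_x f (x, y).
pose c := 2 * l + l ^+ 2 / mu.
have c0 : 0 < c by rewrite addr_gt0 ?mulr_gt0 ?exprn_gt0 ?invr_gt0.
have := le_trans (max_fun_lower x y (- c^-1 *: e)) (max_fun_descent x _).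
rewrite !sqr_enorm.
have -> : gradient g x = e + grad_x f (x, y) by rewrite /e subrK.
rewrite dotDl dotZl !dotZr.
set F := dot (grad_x _ _) _; set N := dot e e => H.
have -> : 4 * l + 2 * l ^+ 2 / mu = 2 * c by rewrite /c; ring.
rewrite -ler_pdivrMl ?mulr_gt0 //.
have -> : (2 * c)^-1 * N = c^-1 * N - c * (c^-1 * (c^-1 * N)) / 2.
  by field; rewrite gt_eqF.
move: H; set ic := c^-1; rewrite /c; lra.
Qed.

End max_function.

(** * Sharper bound on the gradient error, by gradient ascent in [y] *)

Lemma le_of_geometric_error {R : realType} (a b c q : R) :
  0 <= q < 1 -> (forall n, a <= b + c * q ^+ n) -> a <= b.
Proof.
move=> /andP[q0 q1] abc.
have cvgb : (fun n => b + c * q ^+ n) @ \oo --> b.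
  rewrite -[X in _ --> X]addr0; apply: cvgD; first exact: cvg_cst.
  by apply: cvg_geometric; rewrite ger0_norm.
rewrite -(cvg_lim _ cvgb) //; apply: limr_ge; first by apply/cvg_ex; exists b.
exact: nearW.
Qed.

Section gap.
Context {R : realType} {d1 d2 : nat}.
Context (f : 'rV[R]_d1 * 'rV[R]_d2 -> R) (l mu : R).
Context (l_gt0 : 0 < l) (mu_gt0 : 0 < mu) (mu_le_l : mu <= l).
Context (f_diff : forall z, differentiable f z).
Context (f_lip : lipschitz_gradient f l) (f_PL : forall x, PL_neg_y f mu x).

Let g := max_fun f.

Section fixed_x.
Variable x : 'rV[R]_d1.

Let gap y := enorm (gradient g x - grad_x f (x, y)).
Let s y := Num.sqrt (g x - f (x, y)).
Let p y := enorm (grad_y f (x, y)).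
(** With step [eta], the length argument of [next_s] yields the constant
    [l sqrt(2/mu) / (1 - l eta / 2)]; [eta = 1/(2l)] makes it [K]. *)
Let next y := y + (2 * l)^-1 *: grad_y f (x, y).
Let K := 4 / 3 * l * Num.sqrt (2 / mu).
Let q := Num.sqrt (1 - 3 * mu / (4 * l)).

Let sqr_s y : s y ^+ 2 = g x - f (x, y).
Proof. by rewrite sqr_sqrtr // subr_ge0 (max_fun_ge f_PL). Qed.

Let sqr_K : mu * K ^+ 2 = 32 / 9 * l ^+ 2.
Proof.
rewrite /K !exprMn sqr_sqrtr ?divr_ge0 ?ltW //.
by field; rewrite gt_eqF.
Qed.

Let K_ge0 : 0 <= K.
Proof. by rewrite /K mulr_ge0 ?sqrtr_ge0 // mulr_ge0 // ltW. Qed.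

Let s_ge0 y : 0 <= s y. Proof. exact: sqrtr_ge0. Qed.
Let p_ge0 y : 0 <= p y. Proof. exact: enorm_ge0. Qed.

Let ascent_next y : 3 / 8 * p y ^+ 2 <= l * (s y ^+ 2 - s (next y) ^+ 2).
Proof.
have := ascent_y l_gt0 f_diff f_lip x y (2 * l)^-1.
rewrite -/(next y) !sqr_s -/(p y).
have -> : (2 * l)^-1 * (1 - l * (2 * l)^-1 / 2) = 3 / 8 / l.
  by field; rewrite gt_eqF.
rewrite -(ler_pM2l l_gt0) mulrDr.
have -> : l * (3 / 8 / l * p y ^+ 2) = 3 / 8 * p y ^+ 2.
  by field; rewrite gt_eqF.
lra.
Qed.

Let PL_s y : 2 * mu * s y ^+ 2 <= p y ^+ 2.
Proof. by rewrite sqr_s; have [_ ->] := f_PL x. Qed.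

Let gap_next y : gap y <= gap (next y) + p y / 2.
Proof.
rewrite /gap -[_ - grad_x f (x, y)](subrKA (grad_x f (x, next y))).
apply: le_trans (ler_enormD _ _) _; rewrite lerD2l.
have [+ _] := f_lip x x (next y) y.
rewrite subrr enorm0 add0r {2}/next addrAC subrr add0r enormZ.
rewrite gtr0_norm ?invr_gt0 ?mulr_gt0 // -/(p y).
have -> // : l * ((2 * l)^-1 * p y) = p y / 2.
by field; rewrite gt_eqF.
Qed.

(** Lojasiewicz length argument: [s y ^+ 2 - s (next y) ^+ 2] is at most [2 s y (s y - s (next y))]
    and at least [3 p^2 / (8 l)], and PL bounds [s y] by [p y / sqrt(2 mu)]. *)
Let next_s y : p y / 2 <= K * (s y - s (next y)).
Proof.
have K0 : 0 < K by rewrite mulr_gt0 ?mulr_gt0 ?sqrtr_gt0 ?divr_gt0.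
have A := ascent_next y.
have Kp : 8 / 3 * l * s y <= K * p y.
  rewrite -(@ler_pXn2r _ 2) ?nnegrE ?mulr_ge0 ?(ltW l_gt0) //.
  have -> : (8 / 3 * l * s y) ^+ 2 = 64 / 9 * l ^+ 2 * s y ^+ 2 by field.
  rewrite exprMn -(ler_pM2l mu_gt0) (mulrA mu (K ^+ 2)) sqr_K.
  have := ler_wpM2l (sqr_ge0 l) (PL_s y); lra.
have le_s : s (next y) <= s y.
  rewrite -(@ler_pXn2r _ 2) ?nnegrE //.
  rewrite -subr_ge0 -(pmulr_rge0 _ l_gt0); apply: le_trans A.
  by rewrite mulr_ge0 ?sqr_ge0.
(* The general case cancels a factor [s y]. At a maximizer, the ascent estimate itself forces
   [p y = 0]. *)
have [s0|s0] := eqVneq (s y) 0.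
  have p0 : p y ^+ 2 <= 0.
    have := mulr_ge0 (ltW l_gt0) (sqr_ge0 (s (next y))).
    move: A; rewrite s0; lra.
  have -> : p y = 0 by apply/eqP; rewrite -sqrf_eq0 eq_le p0 sqr_ge0.
  by rewrite mul0r mulr_ge0 // subr_ge0.
have {}s0 : 0 < s y by rewrite lt_neqAle eq_sym s0 s_ge0.
rewrite -(ler_pM2l (mulr_gt0 l_gt0 s0)).
have := ler_wpM2l K_ge0 A; have := ler_wpM2r (p_ge0 y) Kp.
have : 0 <= K * l * (s y - s (next y)) ^+ 2.
  by apply: mulr_ge0 (sqr_ge0 _); rewrite mulr_ge0 // ltW.
set S := s (next y); lra.
Qed.

Let q_bounds : 0 <= q < 1.
Proof.
rewrite sqrtr_ge0 -sqrtr1 ltr_sqrt // ltrBlDr ltrDl.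
by rewrite divr_gt0 ?mulr_gt0.
Qed.

Let next_geometric y : s (next y) <= q * s y.
Proof.
rewrite -(@ler_pXn2r _ 2) ?nnegrE ?mulr_ge0 ?sqrtr_ge0 //.
(* By [mu <= l] the radicand in [q] is nonnegative, so [q ^+ 2] equals it and the default value 0 of
   [Num.sqrt] does not intervene. *)
have q0 : 0 <= 1 - 3 * mu / (4 * l).
  rewrite subr_ge0 ler_pdivrMr ?mulr_gt0 // mul1r.
  by apply: ler_pM => //; [exact: ltW | lra].
have sqr_q : q ^+ 2 = 1 - 3 * mu / (4 * l) by rewrite sqr_sqrtr.
rewrite exprMn sqr_q -(ler_pM2l l_gt0).
have -> : l * ((1 - 3 * mu / (4 * l)) * s y ^+ 2)
  = l * s y ^+ 2 - 3 / 8 * (2 * mu * s y ^+ 2).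
  by field; rewrite gt_eqF.
have := PL_s y; have := ascent_next y; lra.
Qed.

(* [gap - K * s] does not decrease along the gradient ascent [next], and tends
   to 0 along it. *)
Lemma gradient_gap y :
  enorm (gradient g x - grad_x f (x, y)) ^+ 2
  <= 32 / 9 * l ^+ 2 / mu * (g x - f (x, y)).
Proof.
pose K0 := Num.sqrt (4 * l + 2 * l ^+ 2 / mu).
have C0 : 0 <= 4 * l + 2 * l ^+ 2 / mu.
  by rewrite addr_ge0 ?divr_ge0 ?mulr_ge0 ?sqr_ge0 // ltW.
(* Induction on the number of ascent steps. The base case is the coarse bound; at each step [K]
   times the decrease of [s] pays for the change of [gap], and the residual term shrinks by [q]. *)
have main n : forall y, gap y <= K * s y + K0 * s y * q ^+ n.
  elim: n => [|n IH] {}y.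
    rewrite expr0 mulr1; apply: (@le_trans _ _ (K0 * s y)); last first.
      by rewrite lerDr mulr_ge0.
    rewrite -(@ler_pXn2r _ 2) ?nnegrE ?mulr_ge0 ?sqrtr_ge0 ?enorm_ge0 //.
    have sqr_K0 : K0 ^+ 2 = 4 * l + 2 * l ^+ 2 / mu by rewrite sqr_sqrtr.
    rewrite exprMn sqr_s sqr_K0.
    exact: sqr_gradient_gap_coarse.
  have := IH (next y); have := gap_next y; have := next_s y.
  have : K0 * s (next y) * q ^+ n <= K0 * s y * q ^+ n.+1.
    rewrite exprS mulrA ler_wpM2r ?exprn_ge0 ?sqrtr_ge0 //.
    by rewrite -mulrA ler_wpM2l ?sqrtr_ge0 // mulrC next_geometric.
  lra.
have le_gap : gap y <= K * s y.
  exact: le_of_geometric_error q_bounds (main ^~ y).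
have : gap y ^+ 2 <= (K * s y) ^+ 2.
  by rewrite ler_sqr ?nnegrE ?(mulr_ge0 K_ge0) ?enorm_ge0.
rewrite exprMn sqr_s => /le_trans; apply.
have -> // : 32 / 9 * l ^+ 2 / mu = K ^+ 2.
by rewrite -sqr_K mulrC mulKf ?gt_eqF.
Qed.

End fixed_x.
End gap.

(** * Expectation at a uniformly drawn index *)

Section uniform_index_expectation.
Context {R : realType} {d : measure_display} {Omega : measurableType d}.
Variables (P : probability Omega R) (U : {RV P >-> nat}).

Let measurable_index (t : nat) : measurable (U @^-1` [set t]).
Proof. by rewrite -[X in measurable X]setTI; exact: measurable_funPT. Qed.

(** The [T + 1] level sets of [U] are disjoint and have total mass 1, so their complement is null
    and the integral splits over them. *)
Lemma expectation_uniform_index (T : nat) (h : nat -> R) :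
  uniform_index U T -> (forall t, 0 <= h t) ->
  ('E_P[fun w => h (U w)] = (T.+1%:R^-1 * \sum_(t < T.+1) h t)%:E)%E.
Proof.
move=> unif h0; rewrite unlock.
pose A (t : nat) := U @^-1` [set t].
pose B := \big[setU/set0]_(t < T.+1) A t.
have trivA : trivIset setT (fun t : 'I_T.+1 => A t).
  by move=> i j _ _ [w [/= Ai Aj]]; apply: val_inj; rewrite /= -Ai -Aj.
have mB : measurable B by apply: bigsetU_measurable => t _;
  exact: measurable_index.
have PA (t : 'I_T.+1) : P (A t) = (T.+1%:R^-1)%:E by rewrite unif // -ltnS.
have PB : P (~` B) = 0%E.
  rewrite probability_setC // measure_bigsetU_ord //; last first.
    by move=> t; exact: measurable_index.
  rewrite (eq_bigr (fun=> (T.+1%:R^-1)%:E)) => [|t _]; last exact: PA.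
  rewrite sumEFin sumr_const card_ord -(mulr_natr T.+1%:R^-1).
  by rewrite mulVf ?pnatr_eq0 // -EFinB subrr.
have mf : measurable_fun setT (EFin \o (h \o U)).
  by apply/measurable_EFinP; apply: (@measurableT_comp _ _ _ _ _ _ h).
have f0 (w : Omega) : (0 <= (h (U w))%:E)%E by rewrite lee_fin.
have mBC : measurable (~` B) by exact: measurableC.
apply: etrans
  (ge0_negligible_integral mBC measurableT mf (fun w _ => f0 w) PB) _.
rewrite setTD setCK /B ge0_integral_bigsetU //=; last 4 first.
- by move=> t; exact: measurable_index.
- exact: index_enum_uniq.
- by apply: sub_trivIset trivA.
- exact: measurable_funTS.
rewrite mulr_sumr -sumEFin; apply: eq_bigr => t _.
rewrite (@eq_integral _ _ _ _ _ (cst (h t)%:E)) => [|w]; last first.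
  by rewrite inE => <-.
rewrite integral_cst; last exact: measurable_index.
rewrite mulrC EFinM; congr (_ * _)%E; exact: PA.
Qed.
End uniform_index_expectation.

(** * One-step decrease of the potential, and its summation *)

Section potential.
Context {R : realType} {d1 d2 : nat}.
Context (f : 'rV[R]_d1 * 'rV[R]_d2 -> R) (l mu : R).
Context (l_gt0 : 0 < l) (mu_gt0 : 0 < mu) (mu_le_l : mu <= l).
Context (f_diff : forall z, differentiable f z).
Context (f_lip : lipschitz_gradient f l) (f_PL : forall x, PL_neg_y f mu x).

Let g := max_fun f.
Let tau := (20 * (l / mu) ^+ 2 * l)^-1.
Let step := agda_step f tau l^-1.
Let k := l / mu.

Let k_ge1 : 1 <= k.
Proof. by rewrite ler_pdivlMr // mul1r. Qed.

Let k_gt0 : 0 < k. Proof. exact: lt_le_trans k_ge1. Qed.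

Let tau_gt0 : 0 < tau.
Proof. by rewrite invr_gt0 mulr_gt0 // mulr_gt0 // exprn_gt0. Qed.

Let tauE : k ^+ 2 * (l * tau) = 1 / 20.
Proof. by rewrite /tau -/k; field; rewrite !gt_eqF. Qed.

Let l_tau_le : l * tau <= 1 / 20.
Proof.
rewrite -tauE ler_peMl ?exprn_ege1 //.
by rewrite mulr_ge0 ?(ltW l_gt0) ?(ltW tau_gt0).
Qed.

(** The curvature of [g] is [(1 + k) l], and [1 + k <= 2 k^2] since [k >= 1]. *)
Let L_tau_le : (l + l ^+ 2 / mu) * tau <= 1 / 10.
Proof.
have -> : (l + l ^+ 2 / mu) * tau = (1 + k) * (l * tau).
  by rewrite /k; field; rewrite gt_eqF.
have -> : 1 / 10 = 2 * k ^+ 2 * (l * tau) :> R by rewrite -mulrA tauE; field.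
rewrite ler_wpM2r //; first by rewrite mulr_ge0 ?(ltW l_gt0) ?(ltW tau_gt0).
by have := k_ge1; nra.
Qed.

Lemma max_fun_agda_step z :
  g (step z).1 <= g z.1 - tau * dot (gradient g z.1) (grad_x f z)
                  + tau / 20 * enorm (grad_x f z) ^+ 2.
Proof.
have := max_fun_descent l_gt0 mu_gt0 f_diff f_lip f_PL z.1
  (- (tau *: grad_x f z)).
move=> /le_trans; apply; rewrite enormN dotNr dotZr enormZ gtr0_norm //.
rewrite lerD2l exprMn.
have tauB := mulr_ge0 (ltW tau_gt0) (sqr_ge0 (enorm (grad_x f z))).
have := ler_wpM2r tauB L_tau_le.
set B := enorm _ ^+ 2; set L := l + _; lra.
Qed.

(** The [x]-step lowers [f (., y)] by at most [tau (1 + l tau / 2) |F|^2], where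
    [l tau / 2 <= 1/40]; by PL, the [y]-step contracts the gap by [1 - 1/k]. *)
Lemma gap_agda_step z :
  g (step z).1 - f (step z) <= (1 - k^-1) *
    (g (step z).1 - f z + tau * (41 / 40) * enorm (grad_x f z) ^+ 2).
Proof.
case: z => x y; rewrite /step /agda_step /=.
set F := grad_x f (x, y); set x' := x - tau *: F.
have lower : f (x, y) - tau * (41 / 40) * enorm F ^+ 2 <= f (x', y).
  have := lsmooth_lower x (- (tau *: F)) (ltW l_gt0) (lsmooth_x f_diff f_lip y).
  apply: le_trans; rewrite -[gradient _ x]/F.
  rewrite enormN dotNr dotZr enormZ gtr0_norm // exprMn -sqr_enorm.
  have := ler_wpM2r (mulr_ge0 (ltW tau_gt0) (sqr_ge0 (enorm F))) l_tau_le.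
  set B := enorm _ ^+ 2; lra.
have up := ascent_y l_gt0 f_diff f_lip x' y l^-1.
have [_ /(_ y) PL] := f_PL x'.
have : f (x', y) + k^-1 * (g x' - f (x', y))
    <= f (x', y + l^-1 *: grad_y f (x', y)).
  apply: le_trans up; rewrite lerD2l.
  have -> : l^-1 * (1 - l * l^-1 / 2) = (2 * l)^-1 by field; rewrite gt_eqF.
  rewrite ler_pdivlMl ?mulr_gt0 //; apply: le_trans PL.
  by rewrite mulrA [leLHS](_ : _ = 2 * mu * (g x' - f (x', y))) // /k;
    field; rewrite !gt_eqF.
have : 0 <= 1 - k^-1 by rewrite subr_ge0 invf_le1.
set b := f (x', _ + _) => k0 step_y.
apply: (@le_trans _ _ ((1 - k^-1) * (g x' - f (x', y)))); first by lra.
rewrite ler_wpM2l //; lra.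
Qed.

(* [a + b / 10], up to the additive constant [inf g]. *)
Let potential z := g z.1 + (g z.1 - f z) / 10.

Lemma potential_agda_step z :
  tau / 4 * enorm (gradient g z.1) ^+ 2 <= potential z - potential (step z).
Proof.
rewrite /potential.
have := max_fun_agda_step z; have := gap_agda_step z.
have := gradient_gap l_gt0 mu_gt0 mu_le_l f_diff f_lip f_PL z.1 z.2.
rewrite -surjective_pairing -/g.
set G := gradient g z.1; set F := grad_x f z.
set b := g z.1 - f z.
set g' := g (step z).1; set b' := g' - f (step z).
rewrite !sqr_enorm dotBl !dotBr (dotC F G).
have DAB : 2 * dot G F <= dot G G + dot F F.
  by have := dotvv_ge0 (G - F); rewrite dotBl !dotBr (dotC F G); lra.
have A0 := dotvv_ge0 G; have B0 := dotvv_ge0 F.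
move: A0 B0 DAB; set A := dot G G; set B := dot F F; set D := dot G F.
have -> : g' - f z = g' - g z.1 + b by rewrite /b; ring.
have : 0 <= k^-1 <= 1 by rewrite invr_ge0 (ltW k_gt0) invf_le1.
set i := k^-1 => /andP[i0 i1] A0 B0 DAB gap b'_le g'_le.
(* The contraction of the gap frees [i * b / 10] in the potential. Since [k^2 l tau = 1/20], the
   weight 9/16 makes the bound of [gradient_gap] equal to exactly this amount. *)
have gap' : 9 / 16 * tau * (A - 2 * D + B) <= i * b / 10.
  have -> : i * b / 10 = 9 / 16 * tau * (32 / 9 * l ^+ 2 / mu * b).
    have -> : 32 / 9 * l ^+ 2 / mu = 32 / 9 * k * l.
      by rewrite /k; field; rewrite gt_eqF.
    have -> : 9 / 16 * tau * (32 / 9 * k * l * b)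
       = 2 * i * b * (k ^+ 2 * (l * tau)).
      by rewrite /i; field; rewrite gt_eqF.
    by rewrite tauE; field.
  by rewrite ler_wpM2l ?mulr_ge0 ?(ltW tau_gt0) //; lra.
have b'_le' : b' <= (1 - i) * (b + tau * (43 / 40 * B - D)).
  apply: le_trans b'_le _; rewrite ler_wpM2l ?subr_ge0 //; lra.
(* The slack left in the claim, rewritten through [D = (A + B - N) / 2] with [N = |G - F|^2]; the
   coefficients of [N], [A] and [B] are nonnegative because [0 <= 1 - i <= 1]. *)
have key : 0 <= tau * ((1 / 8 - (1 - i) / 10) * (A + B - 2 * D) / 2
    + A * (1 / 4 + (1 - i) / 20) + B * (9 / 20 - 23 / 400 * (1 - i))).
  rewrite mulr_ge0 ?(ltW tau_gt0) // !addr_ge0 ?mulr_ge0 ?subr_ge0 //; lra.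
lra.
Qed.

Lemma sum_sqr_gradient z n :
  has_lbound (range g) ->
  \sum_(t < n) enorm (gradient g (iter t step z).1) ^+ 2
  <= 4 / tau * (potential z - inf (range g)).
Proof.
move=> lb.
suff H : tau / 4 * (\sum_(t < n) enorm (gradient g (iter t step z).1) ^+ 2)
    <= potential z - potential (iter n step z).
  have -> : 4 / tau = (tau / 4)^-1 by rewrite invf_div.
  rewrite ler_pdivlMl ?divr_gt0 //; apply: le_trans H _.
  rewrite lerD2l lerN2.
  have inf_le : inf (range g) <= g (iter n step z).1.
    by apply: ge_inf => //; exists (iter n step z).1.
  apply: le_trans inf_le _; rewrite lerDl divr_ge0 // subr_ge0.
  by case: (iter n step z) => x y; exact: max_fun_ge.
elim: n => [|n IH]; first by rewrite big_ord0 mulr0 subrr.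
rewrite big_ord_recr mulrDr /=.
by have := potential_agda_step (iter n step z); lra.
Qed.
End potential.

Theorem theoremD1 (R : realType) (d1 d2 : nat)
    (f : 'rV[R]_d1 * 'rV[R]_d2 -> R) (l mu : R)
    (x0 : 'rV[R]_d1) (y0 : 'rV[R]_d2) (T : nat)
    (d : measure_display) (Omega : measurableType d) (P : probability Omega R)
    (U : {RV P >-> nat})
    (l_gt0 : 0 < l) (mu_gt0 : 0 < mu) (mu_le_l : mu <= l)
    (f_C1 : continuously_differentiable f)
    (f_lip : lipschitz_gradient f l)
    (f_PL : forall x, PL_neg_y f mu x)
    (g_inf_finite : has_lbound (range (max_fun f)))
    (U_unif : uniform_index U T) :
  let g := max_fun f in
  let gstar := inf (range g) in
  let kappa := l / mu in
  let tau1 := (20 * kappa ^+ 2 * l)^-1 in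
  let tau2 := l^-1 in
  let xT := fun w => (agda f tau1 tau2 (x0, y0) (U w)).1 in
  let a0 := g x0 - gstar in
  let b0 := g x0 - f (x0, y0) in
  (forall x, differentiable g x) /\
  ('E_P[fun w => (enorm (gradient g (xT w)) ^+ 2)%R]
    <= (8 / T.+1%:R * (10 * kappa ^+ 2 * l * a0 + kappa ^+ 2 * l * b0))%:E)%E.
Proof.
have [f_diff _ _] := f_C1.
move=> g gstar kappa tau1 tau2 xT a0 b0; split.
  exact: (differentiable_max_fun l_gt0 mu_gt0 f_diff f_lip f_PL).
pose h t := enorm (gradient g (agda f tau1 tau2 (x0, y0) t).1) ^+ 2.
rewrite (expectation_uniform_index (h := h) U_unif); last first.
  by move=> t; exact: sqr_ge0.
(* The gradients at the iterates [0, ..., T] require [T + 1] decreases of the potential, so the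
   telescoping ends one iterate past [T]. *)
have := sum_sqr_gradient l_gt0 mu_gt0 mu_le_l f_diff f_lip f_PL (x0, y0) T.+1
  g_inf_finite.
rewrite -/g -/gstar -/kappa -/tau1 -/tau2 -/a0 -/b0 /= lee_fin => sum_le.
rewrite ler_pdivrMl //; apply: le_trans sum_le _.
(* Both sides agree: [4 / tau1 = 80 kappa^2 l] multiplies [a0 + b0 / 10]. *)
rewrite le_eqVlt; apply/orP; left; apply/eqP.
rewrite /tau1 invrK /a0 /b0; field.
by rewrite nat1r pnatr_eq0.
Qed.
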